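(* Let $\Gamma\rightrightarrows X$ be a groupoid and let $\Lambda:\Gamma\circ Y\to Y$ be an action of $\Gamma$ on a set $Y$ with momentum map $\mu:Y\to X$. Let $\theta=(G,X,\{X_g\},\{\theta_g\})$ be a partial action of a group $G$ on $X$ such that $\Gamma_\theta\cong\Gamma$, and identify $\Gamma$ with $\Gamma_\theta$. For $g\in G$ set $Y_g:=\mu^{-1}(X_g)$ and, for $y\in Y_{g^{-1}}$, $\hat\theta_g(y):=\Lambda(g_{\mu(y)},y)$. Then $\hat\theta:=(G,Y,\{Y_g\},\{\hat\theta_g\})$ is a partial group action of $G$ on $Y$. Furthermore, $\mu$ determines a morphism of partial actions $(\mu,\mathrm{id}_G):\hat\theta\to\theta$.
   Context: Partial action: $\theta=(G,X,\{X_g\},\{\theta_g\})$ of a group $G$ on a set $X$ consists of subsets $X_g\subseteq X$ and bijections $\theta_g:X_{g^{-1}}\to X_g$ such that (i) $X_1=X$, $\theta_1=1_X$; (ii) $\theta_g(X_{g^{-1}}\cap X_{g^{-1}h})\subseteq X_g\cap X_h$; (iii) $\theta_g\theta_h(x)=\theta_{gh}(x)$ for $x\in X_{h^{-1}}\cap X_{h^{-1}g^{-1}}$. A morphism from $(G,X,\{X_g\},\{\alpha_g\})$ to $(S,Y,\{Y_s\},\{\beta_s\})$ is a pair $(\phi_0,\phi_1)$, $\phi_0:X\to Y$ a map, $\phi_1:G\to S$ a group homomorphism, with $\phi_0(X_g)\subseteq Y_{\phi_1(g)}$ and $\phi_0(\alpha_g(x))=\beta_{\phi_1(g)}(\phi_0(x))$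 for $x\in X_{g^{-1}}$. Partial action groupoid $\Gamma_\theta$: object set $X$, arrows $g_x:=(\theta_g(x),g,x)$ with $g\in G$, $x\in X_{g^{-1}}$, source $x$, target $\theta_g(x)$, composition $g_yh_x=(gh)_x$ when $y=\theta_h(x)$. Identifying $\Gamma$ with $\Gamma_\theta$ means that, via a chosen isomorphism, $\Gamma$ is taken to be $\Gamma_\theta$ (with $\mu$ viewed as a map to the object set $X$ of $\Gamma_\theta$ and $\Lambda$ as an action of $\Gamma_\theta$). Groupoid action: given $\Gamma\rightrightarrows X$ with source $\operatorname{s}$ and target $\operatorname{t}$ and a map $\mu:Y\to X$, put $\Gamma\circ Y=\{(\gamma,y)\in\Gamma\times Y:\operatorname{s}(\gamma)=\mu(y)\}$. An action of $\Gamma$ on $Y$ with momentum map $\mu$ is a map $\Lambda:\Gamma\circ Y\to Y$ such that the maps $\Lambda_\gamma=\Lambda(\gamma,-):\mu^{-1}(\operatorname{s}(\gamma))\to Y$ satisfy (i) $\mu(\Lambda_\gamma(y))=\operatorname{t}(\gamma)$; (ii) $\Lambda_{1_x}(y)=y$ for $y\in\mu^{-1}(x)$; (iii) $\Lambda_\alpha\Lambda_\beta(y)=\Lambda_{\alpha\beta}(y)$ whenever $\operatorname{s}(\alpha)=\operatorname{t}(\beta)$ and $y\in\mu^{-1}(\operatorname{s}(\beta))$. *)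

(* Defs.v *)
From HB Require Import structures.
From mathcomp Require Import all_boot.
From mathcomp Require Import boolp classical_sets functions.

Set Implicit Arguments.
Unset Strict Implicit.
Unset Printing Implicit Defensive.

Local Open Scope classical_set_scope.
Local Open Scope group_scope.

(* [th g x hx] is theta_g(x), defined only for x in X_{g^-1}, where
   X_g = D g; that theta_g is a bijection X_{g^-1} -> X_g is [pa_bij]. In
   [pa_comp] the hypothesis [ghx] follows from [hx], [ghx'] and [pa_sub]; it is
   only needed to write theta_g (theta_h x). *)
Record is_partial_action (G : groupType) (X : Type) (D : G -> set X)
    (th : forall (g : G) (x : X), x \in D g^-1 -> X) : Prop :=
  IsPartialAction {
    pa_bij : forall g : G,
      set_bij [set: D g^-1] (D g) (fun u : D g^-1 => th g (val u) (valP u));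
    pa_dom1 : D 1 = [set: X];
    pa_id : forall (x : X) (hx : x \in D 1^-1), th 1 x hx = x;
    pa_sub : forall (g h : G) (x : X) (hx : x \in D g^-1),
      x \in D (g^-1 * h) -> th g x hx \in D g `&` D h;
    pa_comp : forall (g h : G) (x : X) (hx : x \in D h^-1)
        (ghx : th h x hx \in D g^-1) (ghx' : x \in D (g * h)^-1),
      th g (th h x hx) ghx = th (g * h) x ghx'
  }.

Record partial_action (G : groupType) (X : Type) := PartialAction {
  pa_dom : G -> set X;
  pa_map : forall (g : G) (x : X), x \in pa_dom g^-1 -> X;
  pa_axioms : is_partial_action pa_map
}.

Arguments pa_map {G X} p g x _.

(* The proof [hy] always exists when [hx] does, by [pam_dom]. *)
Record is_pa_morphism (G S : groupType) (X Y : Type)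
    (alpha : partial_action G X) (beta : partial_action S Y)
    (phi0 : X -> Y) (phi1 : {multiplicative G -> S}) : Prop :=
  IsPaMorphism {
    pam_dom : forall g : G,
      phi0 @` pa_dom alpha g `<=` pa_dom beta (phi1 g);
    pam_map : forall (g : G) (x : X) (hx : x \in pa_dom alpha g^-1)
        (hy : phi0 x \in pa_dom beta (phi1 g)^-1),
      phi0 (pa_map alpha g x hx) = pa_map beta (phi1 g) (phi0 x) hy
  }.

(* [gcomp a b e] is the composite ab, "b first". *)
Record groupoid (X : Type) := Groupoid {
  arr : Type;
  src : arr -> X;
  tgt : arr -> X;
  gunit : X -> arr;
  ginv : arr -> arr;
  gcomp : forall a b : arr, src a = tgt b -> arr;
  src_unit : forall x, src (gunit x) = x;
  tgt_unit : forall x, tgt (gunit x) = x;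
  src_inv : forall a, src (ginv a) = tgt a;
  tgt_inv : forall a, tgt (ginv a) = src a;
  src_comp : forall a b (e : src a = tgt b), src (gcomp e) = src b;
  tgt_comp : forall a b (e : src a = tgt b), tgt (gcomp e) = tgt a;
  comp_unitl : forall x a (e : src (gunit x) = tgt a), gcomp e = a;
  comp_unitr : forall a x (e : src a = tgt (gunit x)), gcomp e = a;
  comp_invl : forall a (e : src (ginv a) = tgt a), gcomp e = gunit (src a);
  comp_invr : forall a (e : src a = tgt (ginv a)), gcomp e = gunit (tgt a);
  comp_assoc : forall a b c (ab : src a = tgt b) (bc : src b = tgt c)
      (a_bc : src a = tgt (gcomp bc)) (ab_c : src (gcomp ab) = tgt c),
    gcomp a_bc = gcomp ab_c
}.

Arguments arr {X} g.
Arguments src {X g} _.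
Arguments tgt {X g} _.
Arguments gunit {X} g _.
Arguments ginv {X g} _.
Arguments gcomp {X g} a b _.

Record gfunctor (X X' : Type) (C : groupoid X) (C' : groupoid X') := GFunctor {
  fobj : X -> X';
  farr : arr C -> arr C';
  farr_src : forall a, src (farr a) = fobj (src a);
  farr_tgt : forall a, tgt (farr a) = fobj (tgt a);
  farr_unit : forall x, farr (gunit C x) = gunit C' (fobj x);
  farr_comp : forall a b (e : src a = tgt b)
      (e' : src (farr a) = tgt (farr b)),
    farr (gcomp a b e) = gcomp (farr a) (farr b) e'
}.

Record groupoid_iso (X X' : Type) (C : groupoid X) (C' : groupoid X') :=
  GroupoidIso {
    iso_to : gfunctor C C';
    iso_from : gfunctor C' C;
    iso_objK : cancel (fobj iso_to) (fobj iso_from);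
    iso_objVK : cancel (fobj iso_from) (fobj iso_to);
    iso_arrK : cancel (farr iso_to) (farr iso_from);
    iso_arrVK : cancel (farr iso_from) (farr iso_to)
  }.

(* [gact a y e] is Lambda_a(y), defined only for (a, y) in Gamma o Y. The
   equality proofs [e1] in [gact_comp] always exist, by [gact_mu]. *)
Record groupoid_action (X : Type) (C : groupoid X) (Y : Type) (mu : Y -> X) :=
  GroupoidAction {
    gact : forall (a : arr C) (y : Y), src a = mu y -> Y;
    gact_mu : forall a y (e : src a = mu y), mu (gact e) = tgt a;
    gact_unit : forall x y (e : src (gunit C x) = mu y), gact e = y;
    gact_comp : forall a b y (ab : src a = tgt b) (e : src b = mu y)
        (e1 : src a = mu (gact e)) (e2 : src (gcomp a b ab) = mu y),
      gact e1 = gact e2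
  }.

Arguments gact {X C Y mu} g a y _.

Section PartialActionGroupoid.

Variables (G : groupType) (X : Type) (theta : partial_action G X).

Let D := pa_dom theta.
Let th := pa_map theta.
Let ax := pa_axioms theta.

(* The arrow g_x = (theta_g(x), g, x); the first component is determined by the
   other two, so it is not stored. *)
Record pag_arr := PagArr {
  pag_g : G;
  pag_x : X;
  pag_xP : pag_x \in D pag_g^-1
}.

Definition pag_src (a : pag_arr) : X := pag_x a.
Definition pag_tgt (a : pag_arr) : X := th (pag_xP a).

Lemma pag_arr_eq (a b : pag_arr) :
  pag_g a = pag_g b -> pag_x a = pag_x b -> a = b.
Proof.
case: a b => [g x hx] [h y hy] /= gh xy; subst.
by rewrite (Prop_irrelevance hx hy).
Qed.

Lemma th_eq (g h : G) (x y : X) (hx : x \in D g^-1) (hy : y \in D h^-1) :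
  g = h -> x = y -> th hx = th hy.
Proof. by move=> gh xy; subst; rewrite (Prop_irrelevance hx hy). Qed.

Lemma th_dom (g : G) (x : X) (hx : x \in D g^-1) : th hx \in D g.
Proof.
have [f _ _] := pa_bij ax g.
pose u : D g^-1 := exist _ x hx.
have -> : th hx = th (valP u) by exact: th_eq.
exact: mem_set (f u Logic.I).
Qed.

Lemma dom1 (x : X) : x \in D 1^-1.
Proof. by rewrite invg1 /D (pa_dom1 ax) in_setT. Qed.

Lemma thV_dom (g : G) (x : X) (hx : x \in D g^-1) : th hx \in D (g^-1)^-1.
Proof. by rewrite invgK; exact: th_dom. Qed.

Lemma thK (g : G) (x : X) (hx : x \in D g^-1) (h' : th hx \in D (g^-1)^-1) :
  th h' = x.
Proof.
have e : x \in D (g^-1 * g)^-1 by rewrite mulVg; exact: dom1.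
rewrite /th (pa_comp ax h' e) -[RHS](pa_id ax (dom1 x)).
by apply: th_eq; rewrite ?mulVg.
Qed.

Lemma comp_dom (g h : G) (x : X) (hx : x \in D h^-1) :
  th hx \in D g^-1 -> x \in D (g * h)^-1.
Proof.
move=> hg.
have s : th hx \in D ((h^-1)^-1 * (h^-1 * g^-1)) by rewrite mulKg.
have := pa_sub ax (thV_dom hx) s.
rewrite -/D -/th thK invgM => /set_mem[_ ?]; exact: mem_set.
Qed.

Definition pag_unit (x : X) : pag_arr := PagArr (dom1 x).

Definition pag_inv (a : pag_arr) : pag_arr := PagArr (thV_dom (pag_xP a)).

Lemma pag_comp_dom (a b : pag_arr) :
  pag_src a = pag_tgt b -> pag_x b \in D (pag_g a * pag_g b)^-1.
Proof.
move=> e; apply: (@comp_dom _ _ _ (pag_xP b)).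
by rewrite -/(pag_tgt b) -e; exact: pag_xP.
Qed.

Definition pag_comp (a b : pag_arr) (e : pag_src a = pag_tgt b) : pag_arr :=
  PagArr (pag_comp_dom e).

Lemma pag_tgt_unit x : pag_tgt (pag_unit x) = x.
Proof. exact: (pa_id ax). Qed.

Lemma pag_tgt_inv a : pag_tgt (pag_inv a) = pag_src a.
Proof. exact: thK. Qed.

Lemma pag_tgt_comp a b (e : pag_src a = pag_tgt b) :
  pag_tgt (pag_comp e) = pag_tgt a.
Proof.
have hb : th (pag_xP b) \in D (pag_g a)^-1.
  by rewrite -/(pag_tgt b) -e; exact: pag_xP.
rewrite /pag_tgt /= /th -(pa_comp ax hb); exact: th_eq.
Qed.

Lemma pag_comp_unitl x a (e : pag_src (pag_unit x) = pag_tgt a) :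
  pag_comp e = a.
Proof. by apply: pag_arr_eq; rewrite //= mul1g. Qed.

Lemma pag_comp_unitr a x (e : pag_src a = pag_tgt (pag_unit x)) :
  pag_comp e = a.
Proof.
apply: pag_arr_eq; rewrite /= ?mulg1 //.
by move: e; rewrite pag_tgt_unit.
Qed.

Lemma pag_comp_invl a (e : pag_src (pag_inv a) = pag_tgt a) :
  pag_comp e = pag_unit (pag_src a).
Proof. by apply: pag_arr_eq; rewrite //= mulVg. Qed.

Lemma pag_comp_invr a (e : pag_src a = pag_tgt (pag_inv a)) :
  pag_comp e = pag_unit (pag_tgt a).
Proof. by apply: pag_arr_eq; rewrite //= mulgV. Qed.

Lemma pag_comp_assoc a b c (ab : pag_src a = pag_tgt b)
    (bc : pag_src b = pag_tgt c) (a_bc : pag_src a = pag_tgt (pag_comp bc))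
    (ab_c : pag_src (pag_comp ab) = pag_tgt c) :
  pag_comp a_bc = pag_comp ab_c.
Proof. by apply: pag_arr_eq; rewrite //= mulgA. Qed.

Definition pa_groupoid : groupoid X :=
  @Groupoid X pag_arr pag_src pag_tgt pag_unit pag_inv pag_comp
    (fun=> erefl) pag_tgt_unit (fun=> erefl) pag_tgt_inv
    (fun _ _ _ => erefl) pag_tgt_comp pag_comp_unitl pag_comp_unitr
    pag_comp_invl pag_comp_invr pag_comp_assoc.

End PartialActionGroupoid.

Arguments PagArr {G X theta} pag_g pag_x _.

(* An action of C' viewed as an action of C along an isomorphism C ~ C': the
   momentum map becomes F^-1 o mu and Lambda becomes Lambda (F -, -). *)
Section TransportAction.

Variables (X X' Y : Type) (C : groupoid X) (C' : groupoid X') (mu : Y -> X').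
Variables (F : groupoid_iso C C') (L : groupoid_action C' mu).

Definition transport_mu : Y -> X := fobj (iso_from F) \o mu.

Lemma transport_src (a : arr C) (y : Y) :
  src a = transport_mu y -> src (farr (iso_to F) a) = mu y.
Proof. by move=> e; rewrite farr_src e /transport_mu /= iso_objVK. Qed.

Definition transport_gact (a : arr C) (y : Y) (e : src a = transport_mu y) : Y :=
  gact L (farr (iso_to F) a) y (transport_src e).

Lemma transport_gact_mu a y (e : src a = transport_mu y) :
  transport_mu (transport_gact e) = tgt a.
Proof.
by rewrite /transport_mu /= gact_mu farr_tgt iso_objK.
Qed.

Lemma gact_eq (a b : arr C') (y : Y) (e : src a = mu y) (e' : src b = mu y) :
  a = b -> gact L a y e = gact L b y e'.
Proof. by move=> ab; subst; rewrite (Prop_irrelevance e e'). Qed.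

Lemma transport_gact_unit x y (e : src (gunit C x) = transport_mu y) :
  transport_gact e = y.
Proof.
rewrite /transport_gact.
have e' : src (gunit C' (fobj (iso_to F) x)) = mu y.
  by rewrite -farr_unit; exact: transport_src.
by rewrite (gact_eq _ e' (farr_unit _ _)); exact: gact_unit.
Qed.

Lemma transport_gact_comp a b y (ab : src a = tgt b)
    (e : src b = transport_mu y) (e1 : src a = transport_mu (transport_gact e))
    (e2 : src (gcomp a b ab) = transport_mu y) :
  transport_gact e1 = transport_gact e2.
Proof.
have ab' : src (farr (iso_to F) a) = tgt (farr (iso_to F) b).
  by rewrite farr_src farr_tgt ab.
have e' : src (gcomp _ _ ab') = mu y by rewrite src_comp; exact: transport_src.
rewrite /transport_gact (gact_eq _ e' (farr_comp _ ab')); exact: gact_comp.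
Qed.

Definition transport_action : groupoid_action C transport_mu :=
  GroupoidAction transport_gact_mu transport_gact_unit transport_gact_comp.

End TransportAction.

Section InducedPartialAction.

Variables (G : groupType) (X Y : Type) (theta : partial_action G X).
Variables (mu : Y -> X) (L : groupoid_action (pa_groupoid theta) mu).

Definition hat_dom (g : G) : set Y := mu @^-1` pa_dom theta g.

Lemma hat_domP (g : G) (y : Y) :
  y \in hat_dom g -> mu y \in pa_dom theta g.
Proof. by move=> /set_mem ?; exact: mem_set. Qed.

Definition hat_map (g : G) (y : Y) (hy : y \in hat_dom g^-1) : Y :=
  gact L (PagArr g (mu y) (hat_domP hy)) y erefl.

End InducedPartialAction.

(* Main.v *)
Require Import Defs.
From HB Require Import structures.
From mathcomp Require Import all_boot.
From mathcomp Require Import boolp classical_sets functions.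

(** The arrows satisfy [g_(theta_h x) h_x = (g h)_x], so the groupoid action
    axioms give [hat_theta_1 = id] and [hat_theta_g hat_theta_h = hat_theta_(g h)],
    while [mu (hat_theta_g y) = theta_g (mu y)] is the first action axiom. The
    domain conditions pull back along [mu], and [hat_theta_g] is a bijection
    because [hat_theta_(g^-1)] is its inverse. *)

Section InducedPartialActionTheory.

Local Open Scope classical_set_scope.
Local Open Scope group_scope.

Context {G : groupType} {X Y : Type} {theta : partial_action G X}.
Context {mu : Y -> X} (L : groupoid_action (pa_groupoid theta) mu).

Lemma mem_hat_dom (g : G) (y : Y) :
  (y \in hat_dom theta mu g) = (mu y \in pa_dom theta g).
Proof. by []. Qed.

(** Membership proofs are arguments of [hat_map], so [g] or [y] cannot be rewritten in place; proof
    irrelevance makes the value independent of them. *)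
Lemma hat_map_eq (g h : G) (y z : Y) (hy : y \in hat_dom theta mu g^-1)
    (hz : z \in hat_dom theta mu h^-1) :
  g = h -> y = z -> hat_map L hy = hat_map L hz.
Proof. by move=> gh yz; subst; rewrite (Prop_irrelevance hy hz). Qed.

Lemma mu_hat_map (g : G) (y : Y) (hy : y \in hat_dom theta mu g^-1)
    (hx : mu y \in pa_dom theta g^-1) :
  mu (hat_map L hy) = pa_map theta g (mu y) hx.
Proof. by rewrite /hat_map gact_mu; exact: th_eq. Qed.

Lemma hat_map1 (y : Y) (hy : y \in hat_dom theta mu 1^-1) : hat_map L hy = y.
Proof.
rewrite /hat_map -[RHS](@gact_unit _ _ _ _ L (mu y) y erefl).
(* The arrow of [hat_map] at [1] and the unit at [mu y] share group element and source, which
   determine an arrow. *)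
by apply: gact_eq; exact: pag_arr_eq.
Qed.

Lemma hat_mapM (g h : G) (y : Y) (hy : y \in hat_dom theta mu h^-1)
    (ghy : hat_map L hy \in hat_dom theta mu g^-1)
    (ghy' : y \in hat_dom theta mu (g * h)^-1) :
  hat_map L ghy = hat_map L ghy'.
Proof.
pose a : arr (pa_groupoid theta) := PagArr g _ (hat_domP ghy).
pose b : arr (pa_groupoid theta) := PagArr h _ (hat_domP hy).
(* The source of [a] is [mu (hat_map L hy)]. *)
have ab : src a = tgt b by exact: (gact_mu L).
rewrite /hat_map (@gact_comp _ _ _ _ L a b y ab erefl erefl erefl).
by apply: gact_eq; exact: pag_arr_eq.
Qed.

Lemma hat_dom1 (y : Y) : y \in hat_dom theta mu 1^-1.
Proof. by rewrite mem_hat_dom; exact: dom1. Qed.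

Lemma hat_map_dom (g : G) (y : Y) (hy : y \in hat_dom theta mu g^-1) :
  hat_map L hy \in hat_dom theta mu g.
Proof. by rewrite mem_hat_dom (mu_hat_map _ _ _ (hat_domP hy)); exact: th_dom. Qed.

(** A general [k] covers both [g^-1 * g] for injectivity and [g * g^-1] for surjectivity, without
    rewriting [(g^-1)^-1] inside [hat_map]. *)
Lemma hat_mapK (g k : G) (y : Y) (hy : y \in hat_dom theta mu g^-1)
    (hk : hat_map L hy \in hat_dom theta mu k^-1) :
  k * g = 1 -> hat_map L hk = y.
Proof.
move=> kg; have e : y \in hat_dom theta mu (k * g)^-1.
  by rewrite kg; exact: hat_dom1.
by rewrite (hat_mapM _ _ _ hy hk e) -[RHS](hat_map1 _ (hat_dom1 y)); exact: hat_map_eq.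
Qed.

Lemma hat_map_bij (g : G) :
  set_bij [set: hat_dom theta mu g^-1] (hat_dom theta mu g)
    (fun u : hat_dom theta mu g^-1 => hat_map L (valP u)).
Proof.
have domV (u : hat_dom theta mu g^-1) :
    hat_map L (valP u) \in hat_dom theta mu (g^-1)^-1.
  by rewrite invgK; exact: hat_map_dom.
split=> [u _|u v _ _ uv|y hy].
- exact: set_mem (hat_map_dom _ _ (valP u)).
(* Applying [hat_theta_(g^-1)] to both sides of [uv] recovers [u] and [v]. *)
- apply: val_inj; rewrite -(hat_mapK _ _ _ _ (domV u) (mulVg g)).
  rewrite -[RHS](hat_mapK _ _ _ _ (domV v) (mulVg g)).
  exact: hat_map_eq.
- have hyV : y \in hat_dom theta mu (g^-1)^-1 by rewrite invgK; exact: mem_set.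
  (* The preimage of [y] is [hat_theta_(g^-1) y]. *)
  exists (exist _ (hat_map L hyV) (hat_map_dom _ _ hyV)) => //.
  by apply: hat_mapK; rewrite mulgV.
Qed.

Lemma hat_map_partial_action : is_partial_action (hat_map L).
Proof.
split.
- exact: hat_map_bij.
- by rewrite /hat_dom (pa_dom1 (pa_axioms theta)) preimage_setT.
- exact: hat_map1.
- move=> g h y hy hgh; apply: mem_set.
  (* By conversion [hgh] places [mu y] in [pa_dom theta (g^-1 * h)]. *)
  have := set_mem (pa_sub (pa_axioms theta) (hat_domP hy) hgh).
  by rewrite -(mu_hat_map _ _ hy).
- exact: hat_mapM.
Qed.

Lemma mu_pa_morphism (hat_theta : is_partial_action (hat_map L)) :
  is_pa_morphism (PartialAction hat_theta) theta mu idfun.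
Proof. by split=> [g _ [y hy <-]|g y hy hx] //; exact: mu_hat_map. Qed.

End InducedPartialActionTheory.

Theorem proposition2p6 (X Y : Type) (Gamma : groupoid X) (mu : Y -> X)
    (Lambda : groupoid_action Gamma mu)
    (G : groupType) (theta : partial_action G X)
    (F : groupoid_iso (pa_groupoid theta) Gamma) :
  let mu' : Y -> X := transport_mu mu F in
  let Lambda' : groupoid_action (pa_groupoid theta) mu' :=
    transport_action F Lambda in
  exists hat_theta : is_partial_action (hat_map Lambda'),
    is_pa_morphism (PartialAction hat_theta) theta mu' idfun.
Proof.
move=> mu' Lambda'; exists (hat_map_partial_action Lambda').
exact: mu_pa_morphism.
Qed.
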